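(* Let $\mathcal{C}$ be an integral finite tensor category with Grothendieck ring $A$, and let $D$ be the greatest common divisor of the dimensions of the projective objects of $\mathcal{C}$. Then $$\mathrm{FPdim}(\mathcal{C})=D\cdot\mathrm{FPdim}(A).$$
   Context: Tensor categories are over an algebraically closed field $\mathbf{k}$. A finite tensor category is a $\mathbf{k}$-linear finite abelian category with a rigid monoidal structure, with $\mathbf{k}$-bilinear tensor product and $\mathrm{End}(\mathbf{1})=\mathbf{k}$. It is integral if the Frobenius-Perron dimensions of all its objects are integers; equivalently $\mathcal{C}=\mathrm{Rep}\,H$ for a finite dimensional quasi-Hopf algebra $H$, Frobenius-Perron dimensions (called simply dimensions) of objects then being their vector space dimensions, and $\mathrm{FPdim}(\mathcal{C})=\dim H=\sum_i \dim(X_i)\dim(P_i)$, where $X_i$ are the simple objects and $P_i$ their projective covers. The Grothendieck ring $A$, with basis $b_i=[X_i]$ and $b_0=[\mathbf{1}]=1$, is a transitive unital $\mathbb{Z}_+$-ring of finite rank: $b_ib_j=\sum_kN_{ij}^kb_k$ with $N_{ij}^k\in\mathbb{Z}_{\ge0}$, and for each $j,k$ there exists $i$ with $N_{ij}^k>0$. For such a ring there is a unique ring homomorphism $\mathrm{FPdim}:A\to\mathbb{R}$ with $d_i:=\mathrm{FPdim}(b_i)>0$ for all $i$. Let $N_i$ be the matrix with $(j,k)$-entry $N_{ij}^k$. There is a row vector $\mathbf{p}=(p_i)$ with positive entries, unique up to a positive scalar, with $\mathbf{p}N_i=d_i\mathbf{p}$ for all $i$. If $\mathrm{FPdim}$ is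 integer valued ($A$ is integral), $\mathbf{p}$ is normalized canonically so that the $p_i$ are positive integers with greatest common divisor $1$, and $\mathrm{FPdim}(A):=\sum_ip_id_i$. *)

(* Defs.v *)
From HB Require Import structures.
From mathcomp Require Import all_boot all_order all_algebra.
From mathcomp Require Import reals.

Set Implicit Arguments.
Unset Strict Implicit.
Unset Printing Implicit Defensive.

Import Order.TTheory GRing.Theory Num.Theory.

Local Open Scope ring_scope.

(* Hom spaces are vectType, so they are finite dimensional by construction. *)
Record linCat (k : fieldType) := LinCat {
  obj :> Type;
  hom : obj -> obj -> vectType k;
  idm : forall X, hom X X;
  hcomp : forall X Y Z, hom Y Z -> hom X Y -> hom X Z;
  hcomp_idl : forall X Y (f : hom X Y), hcomp (idm Y) f = f;
  hcomp_idr : forall X Y (f : hom X Y), hcomp f (idm X) = f;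
  hcompA : forall X Y Z W (h : hom Z W) (g : hom Y Z) (f : hom X Y),
    hcomp h (hcomp g f) = hcomp (hcomp h g) f;
  hcomp_linearl : forall X Y Z (f : hom X Y),
    linear (fun g : hom Y Z => hcomp g f);
  hcomp_linearr : forall X Y Z (g : hom Y Z),
    linear (fun f : hom X Y => hcomp g f)
}.

Arguments hom {k l} X Y.
Arguments idm {k l} X.
Arguments hcomp {k l X Y Z} g f.

Notation "g \oc f" := (hcomp g f) (at level 40, left associativity).

Section Abelian.
Variables (k : fieldType) (C : linCat k).
Implicit Types X Y Z M P S : C.

Definition mono X Y (f : hom X Y) : Prop :=
  forall T (g h : hom T X), f \oc g = f \oc h -> g = h.

Definition epi X Y (f : hom X Y) : Prop :=
  forall T (g h : hom Y T), g \oc f = h \oc f -> g = h.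

Definition is_iso X Y (f : hom X Y) : Prop :=
  exists g : hom Y X, g \oc f = idm X /\ f \oc g = idm Y.

Definition isomorphic X Y : Prop := exists f : hom X Y, is_iso f.

Definition zero_object Z : Prop :=
  (forall X (f : hom X Z), f = 0) /\ (forall X (f : hom Z X), f = 0).

Definition is_kernel X Y (f : hom X Y) K (i : hom K X) : Prop :=
  f \oc i = 0 /\
  forall T (g : hom T X), f \oc g = 0 -> exists! h : hom T K, i \oc h = g.

Definition is_cokernel X Y (f : hom X Y) Q (q : hom Y Q) : Prop :=
  q \oc f = 0 /\
  forall T (g : hom Y T), g \oc f = 0 -> exists! h : hom Q T, h \oc q = g.

Definition has_biproduct X Y : Prop :=
  exists (B : C) (i1 : hom X B) (i2 : hom Y B) (p1 : hom B X) (p2 : hom B Y),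
  [/\ p1 \oc i1 = idm X, p2 \oc i2 = idm Y, p1 \oc i2 = 0, p2 \oc i1 = 0
    & i1 \oc p1 + i2 \oc p2 = idm B].

Definition abelian_category : Prop :=
  [/\ exists Z, zero_object Z,
      forall X Y, has_biproduct X Y,
      forall X Y (f : hom X Y), (exists K (i : hom K X), is_kernel f i) /\
                                (exists Q (q : hom Y Q), is_cokernel f q),
      forall X Y (f : hom X Y), mono f -> exists Z (g : hom Y Z), is_kernel g f
    & forall X Y (f : hom X Y), epi f -> exists Z (g : hom Z X), is_cokernel g f].

Definition short_exact X Y Z (i : hom X Y) (q : hom Y Z) : Prop :=
  is_kernel q i /\ is_cokernel i q.

Definition simple_object S : Prop :=
  ~ zero_object S /\
  forall Y (m : hom Y S), mono m -> zero_object Y \/ is_iso m.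

(* The existence of a finite filtration with simple subquotients. *)
Inductive finite_length : C -> Prop :=
| finite_length0 M : zero_object M -> finite_length M
| finite_lengthS X M S (i : hom X M) (q : hom M S) :
    short_exact i q -> simple_object S -> finite_length X -> finite_length M.

Definition projective P : Prop :=
  forall X Y (q : hom X Y) (f : hom P Y), epi q -> exists g : hom P X, q \oc g = f.

(* A projective P with an essential epimorphism onto X. *)
Definition projective_cover X P : Prop :=
  projective P /\
  exists2 q : hom P X, epi q &
    forall Y (f : hom Y P), epi (q \oc f) -> epi f.

Definition simple_reps n (X : 'I_n -> C) : Prop :=
  [/\ forall i, simple_object (X i),
      forall i j, isomorphic (X i) (X j) -> i = j
    & forall S, simple_object S -> exists i, isomorphic S (X i)].

Definition finite_abelian_category : Prop :=
  [/\ abelian_category,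
      forall M, finite_length M,
      forall S, simple_object S -> exists P, projective_cover S P
    & exists n (X : 'I_n -> C), simple_reps X].

End Abelian.

Record monoidal (k : fieldType) (C : linCat k) := Monoidal {
  tens : C -> C -> C;
  tensm : forall X X' Y Y' : C,
    hom X X' -> hom Y Y' -> hom (tens X Y) (tens X' Y');
  tensm_id : forall X Y : C, tensm (idm X) (idm Y) = idm (tens X Y);
  tensm_comp : forall (X X' X'' Y Y' Y'' : C) (f' : hom X' X'') (f : hom X X')
      (g' : hom Y' Y'') (g : hom Y Y'),
    tensm (f' \oc f) (g' \oc g) = tensm f' g' \oc tensm f g;
  tunit : C;
  assoc : forall X Y Z : C, hom (tens (tens X Y) Z) (tens X (tens Y Z));
  assocV : forall X Y Z : C, hom (tens X (tens Y Z)) (tens (tens X Y) Z);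
  assocK : forall X Y Z : C, assocV X Y Z \oc assoc X Y Z = idm _;
  assocVK : forall X Y Z : C, assoc X Y Z \oc assocV X Y Z = idm _;
  assoc_nat : forall (X X' Y Y' Z Z' : C)
      (f : hom X X') (g : hom Y Y') (h : hom Z Z'),
    assoc X' Y' Z' \oc tensm (tensm f g) h =
    tensm f (tensm g h) \oc assoc X Y Z;
  lunit : forall X : C, hom (tens tunit X) X;
  lunit_iso : forall X : C, is_iso (lunit X);
  lunit_nat : forall (X Y : C) (f : hom X Y),
    lunit Y \oc tensm (idm tunit) f = f \oc lunit X;
  runit : forall X : C, hom (tens X tunit) X;
  runit_iso : forall X : C, is_iso (runit X);
  runit_nat : forall (X Y : C) (f : hom X Y),
    runit Y \oc tensm f (idm tunit) = f \oc runit X;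
  pentagon : forall W X Y Z : C,
    assoc W X (tens Y Z) \oc assoc (tens W X) Y Z =
    tensm (idm W) (assoc X Y Z) \oc assoc W (tens X Y) Z
      \oc tensm (assoc W X Y) (idm Z);
  triangle : forall X Y : C,
    tensm (idm X) (lunit Y) \oc assoc X tunit Y = tensm (runit X) (idm Y)
}.

Definition bilinear_tensor (k : fieldType) (C : linCat k) (m : monoidal C) :
    Prop :=
  forall X X' Y Y' : C,
    (forall g : hom Y Y', linear (fun f : hom X X' => tensm m f g)) /\
    (forall f : hom X X', linear (fun g : hom Y Y' => tensm m f g)).

(* Y is a left dual of X, equivalently X is a right dual of Y. *)
Definition dual_pair (k : fieldType) (C : linCat k) (m : monoidal C) (X Y : C) :
    Prop :=
  exists (ev : hom (tens m Y X) (tunit m)) (coev : hom (tunit m) (tens m X Y)),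
    runit m X \oc tensm m (idm X) ev \oc assoc m X Y X
      \oc tensm m coev (idm X) = lunit m X
 /\ lunit m Y \oc tensm m ev (idm Y) \oc assocV m Y X Y
      \oc tensm m (idm Y) coev = runit m Y.

Definition rigid (k : fieldType) (C : linCat k) (m : monoidal C) : Prop :=
  forall X : C, (exists Y, dual_pair m X Y) /\ (exists Y, dual_pair m Y X).

Record finTensorCat (k : closedFieldType) := FinTensorCat {
  ftc_cat :> linCat k;
  ftc_finite : finite_abelian_category ftc_cat;
  ftc_mon : monoidal ftc_cat;
  ftc_bilinear : bilinear_tensor ftc_mon;
  ftc_rigid : rigid ftc_mon;
  ftc_unit : bijective (fun a : k => a *: idm (tunit ftc_mon))
}.

(* The Grothendieck ring of C: the free abelian group on the classes of the
   simple objects X i, where the class of an object is additive on short exact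
   sequences (so that gr_coord (gr_class M) lists the Jordan-Hoelder
   multiplicities of M) and the product is induced by the tensor product.
   These data are unique up to a unique isomorphism. *)
Record grothendieckRing (k : closedFieldType) (C : finTensorCat k)
    n (X : 'I_n -> C) := GrothendieckRing {
  gr_ring :> nzRingType;
  gr_class : C -> gr_ring;
  gr_exact : forall (K M Q : C) (i : hom K M) (q : hom M Q),
    short_exact i q -> gr_class M = gr_class K + gr_class Q;
  gr_unit : gr_class (tunit (ftc_mon C)) = 1;
  gr_tens : forall M M' : C,
    gr_class (tens (ftc_mon C) M M') = gr_class M * gr_class M';
  gr_coord : gr_ring -> 'rV[int]_n;
  gr_coordK : forall a, \sum_(i < n) gr_class (X i) *~ gr_coord a 0 i = a;
  gr_coord_sum : forall c : 'rV[int]_n,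
    gr_coord (\sum_(i < n) gr_class (X i) *~ c 0 i) = c
}.

Section FPdim.
Variables (k : closedFieldType) (C : finTensorCat k).
Variables (n : nat) (X : 'I_n -> C) (A : grothendieckRing X).
Variables (R : realType) (FPdim : {rmorphism A -> R}).

Definition structure_mx (i : 'I_n) : 'M[int]_n :=
  \matrix_(j, l) gr_coord (gr_class A (X i) * gr_class A (X j)) 0 l.

Definition FPdim_character : Prop := forall i, 0 < FPdim (gr_class A (X i)).

Definition FPdim_obj (M : C) : R := FPdim (gr_class A M).

Definition integral_category : Prop := forall M : C, FPdim_obj M \is a Num.int.

Definition FPdim_cat (P : 'I_n -> C) : R :=
  \sum_(i < n) FPdim_obj (X i) * FPdim_obj (P i).

Definition gcd_projective_dims (D : nat) : Prop :=
  (forall (P : C) (m : nat), projective P -> FPdim_obj P = m%:R -> (D %| m)%N)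
  /\ forall e : nat,
     (forall (P : C) (m : nat), projective P -> FPdim_obj P = m%:R -> (e %| m)%N)
     -> (e %| D)%N.

Definition canonical_left_eigenvector (p : 'rV[nat]_n) : Prop :=
  [/\ forall i, (0 < p ord0 i)%N,
      forall i, map_mx (GRing.natmul 1) p *m map_mx intr (structure_mx i)
                = FPdim_obj (X i) *: map_mx (GRing.natmul 1) p
    & \big[gcdn/0%N]_(i < n) p ord0 i = 1%N].

Definition FPdim_ring (p : 'rV[nat]_n) : R :=
  \sum_(i < n) (p ord0 i)%:R * FPdim_obj (X i).

End FPdim.

(* Main.v *)
Require Import Defs.
From HB Require Import structures.
From mathcomp Require Import all_boot all_order all_algebra.
From mathcomp Require Import reals.
Import Defs.

Set Implicit Arguments.
Unset Strict Implicit.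
Unset Printing Implicit Defensive.

Import Order.TTheory GRing.Theory Num.Theory.

Local Open Scope ring_scope.

(** Write d_i and pi_i for the dimensions of X_i and of its projective cover
P_i, and c_l(a) for the multiplicity of X_l in a class a. Two facts turn
questions about projective objects into questions about the Grothendieck ring:
- dim Hom(P_l, M) = c_l([M]), by Schur's lemma and the exactness of
  Hom(P_l, -) ([hdim_coverE]);
- a projective object Q splits into covers, so that
  [Q] = sum_j dim Hom(Q, X_j) [P_j] ([projective_class]). Hence D is the gcd of
  the pi_j.

If N is a dual of M, then N (x) P_i is projective and
Hom(N (x) P_i, X_j) = Hom(P_i, M (x) X_j), whence
[N][P_i] = sum_j c_i([M][X_j]) [P_j] ([cover_mull]). On dimensions, with
M = X_i, this says that the vector pi satisfies
sum_j pi_j c_l([X_i][X_j]) = dim(N) pi_l, and pairing it with the right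
eigenvector (d_l) forces dim(N) = d_i. So pi, like p, is a common left
eigenvector for the d_i ([dim_cover_eigenvector]).

The proportionality of pi and p comes from the regular representation. The
mirror image of the formula for [N][P_i] ([cover_mulr]) shows that the class
r = sum_i d_i [P_i] absorbs right multiplication: r [M] = dim(M) r
([regular_class_absorbs]). If v is a left eigenvector, evaluating the
eigenvector equation at r instead of at the [X_i] yields
FPdim(r) v_l = (sum_j v_j d_j) c_l(r), so every left eigenvector is a multiple
of the coordinates of r. Here FPdim(r) = sum_i d_i pi_i = FPdim(C) > 0. Taking
v = pi gives c_l(r) = pi_l; taking v = p gives
FPdim(C) p_l = FPdim(A) pi_l for all l ([left_eigenvector_dim_cover]), and the
gcd over l of this identity is the claim. *)

(** * Linear algebra *)
Lemma dim_exact (k : fieldType) (U V W : vectType k) (u : U -> V) (v : V -> W) :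
  linear u -> linear v -> injective u -> (forall w, exists x, v x = w) ->
  (forall x, v x = 0 <-> exists y, u y = x) ->
  \dim {:V} = (\dim {:U} + \dim {:W})%N.
Proof.
move=> lu lv uI vS ex.
pose lul := HB.pack_for {linear U -> V} u (GRing.isLinear.Build k U V _ u lu).
pose lvl := HB.pack_for {linear V -> W} v (GRing.isLinear.Build k V W _ v lv).
pose f := linfun lul; pose g := linfun lvl.
have fE x : f x = u x by rewrite lfunE.
have gE x : g x = v x by rewrite lfunE.
have imf : limg f = lker g.
  apply/vspaceP => x; rewrite memv_ker gE; apply/memv_imgP/eqP.
    by case=> y _ ->; apply/ex; exists y; rewrite fE.
  by move/ex=> [y <-]; exists y; rewrite ?memvf ?fE.
have img : limg g = {:W}%VS.
  apply/vspaceP => w; rewrite memvf; apply/memv_imgP.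
  by have [x <-] := vS w; exists x; rewrite ?memvf ?gE.
have kerf : lker f == 0%VS.
  rewrite -subv0; apply/subvP => x; rewrite memv_ker memv0 fE => /eqP ux0.
  by apply/eqP/uI; rewrite ux0 -fE linear0.
rewrite -(limg_ker_dim g {:V}) capfv img -imf limg_dim_eq //.
by rewrite (eqP kerf) capv0.
Qed.

Lemma dim_bij (k : fieldType) (U V : vectType k) (u : U -> V) :
  linear u -> bijective u -> \dim {:U} = \dim {:V}.
Proof.
move=> lu [u' uK u'K].
have := @dim_exact k U V 'rV[k]_0 u (fun=> 0) lu.
rewrite [\dim {:'rV_0}]dimvf addn0 => -> //.
- by move=> a x y; rewrite scaler0 addr0.
- exact: can_inj uK.
- by move=> w; exists 0; apply/rowP=> -[].
- by move=> x; split=> // _; exists (u' x).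
Qed.

Section Eigenvector.
Import VectorInternalTheory.

(** The matrix of [f] in coordinates has an eigenvalue because its
characteristic polynomial has positive degree as soon as V is nonzero. *)
Lemma closed_eigenvector (k : closedFieldType) (V : vectType k) (f : V -> V)
    (v0 : V) :
  linear f -> v0 != 0 -> exists a, exists2 w, w != 0 & f w = a *: w.
Proof.
move=> lf v0n.
pose F := HB.pack_for {linear V -> V} f (GRing.isLinear.Build k V V _ f lf).
pose M := lin1_mx (v2r \o F \o r2v).
have [|a] := closed_rootP (char_poly M) _.
  rewrite size_char_poly eqSS; apply/eqP => d0.
  case/eqP: v0n; apply: (can_inj v2rK); rewrite linear0.
  by apply/rowP => i; have := ltn_ord i; rewrite {2}d0 ltn0.
rewrite -eigenvalue_root_char => /eigenvalueP[w wE wn]; exists a.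
exists (r2v w); first by rewrite -(inj_eq (can_inj v2rK)) r2vK linear0.
by apply: (can_inj v2rK); rewrite linearZ /= r2vK -wE mul_rV_lin1.
Qed.

End Eigenvector.
(** [linear] is a bare predicate here, as in the axioms of a linear category,
so its consequences are needed without a bundled morphism. *)
Section LinearMaps.
Variables (k : fieldType) (U V : lmodType k) (f : U -> V).
Hypothesis lf : linear f.

Lemma lin_B : {morph f : x y / x - y}.
Proof. by move=> x y; rewrite addrC -scaleN1r lf scaleN1r addrC. Qed.

Lemma lin_0 : f 0 = 0.
Proof. by rewrite -(subrr 0) lin_B subrr. Qed.

Lemma lin_Z a : {morph f : x / a *: x}.
Proof. by move=> x; rewrite -[a *: x]addr0 lf lin_0 addr0. Qed.

End LinearMaps.

(** * Abelian categories and dimensions of Hom spaces *)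

Section LinearCategory.
Variables (k : fieldType) (C : linCat k).
Implicit Types M N L S K Q P : C.

Lemma hcompBl M N L (f : hom M N) (g h : hom N L) :
  (g - h) \oc f = g \oc f - h \oc f.
Proof. exact: (lin_B (hcomp_linearl f)). Qed.

Lemma hcompBr M N L (f : hom N L) (g h : hom M N) :
  f \oc (g - h) = f \oc g - f \oc h.
Proof. exact: (lin_B (hcomp_linearr f)). Qed.

Lemma hcomp0l M N L (f : hom M N) : (0 : hom N L) \oc f = 0.
Proof. exact: (lin_0 (hcomp_linearl f)). Qed.

Lemma hcomp0r M N L (f : hom N L) : f \oc (0 : hom M N) = 0.
Proof. exact: (lin_0 (hcomp_linearr f)). Qed.

Lemma hcompZl M N L (f : hom M N) a (g : hom N L) :
  (a *: g) \oc f = a *: (g \oc f).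
Proof. exact: (lin_Z (hcomp_linearl f)). Qed.

Lemma zero_objectP M : zero_object M <-> idm M = 0.
Proof.
split=> [[z _]|z]; first exact: z.
split=> L f; first by rewrite -[f]hcomp_idl z hcomp0l.
by rewrite -[f]hcomp_idr z hcomp0r.
Qed.

Lemma mono0 M N (f : hom M N) :
  mono f <-> forall L (g : hom L M), f \oc g = 0 -> g = 0.
Proof.
split=> [mf L g fg|mf L g h fgh]; first by apply: mf; rewrite hcomp0r.
by apply/subr0_eq/mf; rewrite hcompBr fgh subrr.
Qed.

Lemma epi0 M N (f : hom M N) :
  epi f <-> forall L (g : hom N L), g \oc f = 0 -> g = 0.
Proof.
split=> [ef L g gf|ef L g h gfh]; first by apply: ef; rewrite hcomp0l.
by apply/subr0_eq/ef; rewrite hcompBl gfh subrr.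
Qed.

Lemma epi_comp M N L (f : hom M N) (g : hom N L) :
  epi f -> epi g -> epi (g \oc f).
Proof. by move=> ef eg T a b; rewrite !hcompA => /ef/eg. Qed.

Lemma is_iso_epi M N (f : hom M N) : is_iso f -> epi f.
Proof.
case=> g [_ fg] L a b e.
by rewrite -[a]hcomp_idr -[b]hcomp_idr -fg !hcompA e.
Qed.

Lemma kernel_mono M N (f : hom M N) K (i : hom K M) : is_kernel f i -> mono i.
Proof.
case=> fi univ L g h e.
have [|u [_ uU]] := univ _ (i \oc g); first by rewrite hcompA fi hcomp0l.
by rewrite -(uU g erefl); apply: uU.
Qed.

Lemma cokernel_epi M N (f : hom M N) Q (q : hom N Q) : is_cokernel f q -> epi q.
Proof.
case=> qf univ L g h e.
have [|u [_ uU]] := univ _ (g \oc q); first by rewrite -hcompA qf hcomp0r.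
by rewrite -(uU g erefl); apply: uU.
Qed.

Lemma epi_neq0 M S (f : hom M S) : ~ zero_object S -> epi f -> f != 0.
Proof.
move=> nz /epi0 ef; apply/eqP=> f0; apply/nz/zero_objectP/ef.
by rewrite f0 hcomp0r.
Qed.

Lemma projective_retract P Q (i : hom Q P) (r : hom P Q) :
  projective P -> r \oc i = idm Q -> projective Q.
Proof.
move=> pP ri M N q f eq; have [g gE] := pP _ _ q (f \oc r) eq.
by exists (g \oc i); rewrite hcompA gE -hcompA ri hcomp_idr.
Qed.

Section Abelian.
Hypothesis abC : abelian_category C.

Lemma ex_kernel M N (f : hom M N) : exists K (i : hom K M), is_kernel f i.
Proof. by case: abC => _ _ /(_ M N f) []. Qed.

(** The kernel of any [g] with g f = 0 is a subobject of S through which f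
factors; it is not zero, so it is all of S and g = 0. *)
Lemma simple_epi M S (f : hom M S) : simple_object S -> f != 0 -> epi f.
Proof.
move=> [_ sS] fn; apply/epi0 => L g gf.
have [K [m km]] := ex_kernel g.
have [u [uE _]] := km.2 _ _ gf.
have [zK|[h [_ mh]]] := sS _ m (kernel_mono km).
  by case/eqP: fn; rewrite -uE (zK.1 _ u) hcomp0r.
by rewrite -[g]hcomp_idr -mh hcompA km.1 hcomp0l.
Qed.

Lemma simple_mono S M (f : hom S M) : simple_object S -> f != 0 -> mono f.
Proof.
move=> [_ sS] fn; apply/mono0 => L g fg.
have [K [m km]] := ex_kernel f.
have [u [uE _]] := km.2 _ _ fg.
have [zK|[h [_ mh]]] := sS _ m (kernel_mono km).
  by rewrite -uE (zK.1 _ u) hcomp0r.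
by case/eqP: fn; rewrite -[f]hcomp_idr -mh hcompA km.1 hcomp0l.
Qed.

(** The epimorphism f is the cokernel of some g, and g = 0 because f is mono,
so that the identity factors through f. *)
Lemma mono_epi_iso M N (f : hom M N) : mono f -> epi f -> is_iso f.
Proof.
move=> mf ef; case: abC => _ _ _ _ /(_ _ _ _ ef) [Z [g [fg univ]]].
have g0 : g = 0 by move/mono0: mf; apply.
have [|h [hf _]] := univ _ (idm M); first by rewrite g0 hcomp0r.
by exists h; split=> //; apply: ef; rewrite -hcompA hf hcomp_idl hcomp_idr.
Qed.

(** An epimorphism is the cokernel of some map g; since g factors through the
kernel, it is also the cokernel of its kernel. *)
Lemma epi_exact M N (q : hom M N) K (i : hom K M) :
  epi q -> is_kernel q i -> short_exact i q.
Proof.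
move=> eq ki; split=> //; split=> [|L f fi]; first exact: ki.1.
case: abC => _ _ _ _ /(_ _ _ _ eq) [Z [g [qg univ]]].
have [g' [gE _]] := ki.2 _ _ qg.
have [|h [hE _]] := univ _ f; first by rewrite -gE hcompA fi hcomp0l.
by exists h; split=> // h' h'E; apply: eq; rewrite hE.
Qed.

(** The retraction onto the kernel is the factorization of 1 - s f. *)
Lemma split_epi_exact M N (f : hom M N) (s : hom N M) K (i : hom K M) :
  f \oc s = idm N -> is_kernel f i ->
  short_exact i f /\ exists r : hom M K, r \oc i = idm K.
Proof.
move=> fs ki; split.
  apply: epi_exact => //; apply/epi0 => L g gf.
  by rewrite -[g]hcomp_idr -fs hcompA gf hcomp0l.
have [|r [rE _]] := ki.2 _ (idm M - s \oc f).
  by rewrite hcompBr hcompA fs hcomp_idl hcomp_idr subrr.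
exists r; apply: (kernel_mono ki).
by rewrite hcompA rE hcompBl -hcompA ki.1 hcomp0r subr0 hcomp_idl hcomp_idr.
Qed.

Lemma simple_nonzero_iso S T (f : hom S T) :
  simple_object S -> simple_object T -> f != 0 -> is_iso f.
Proof.
move=> sS sT fn; apply: mono_epi_iso; [exact: simple_mono | exact: simple_epi].
Qed.

End Abelian.

Definition hdim M N := \dim {: hom M N}.

Lemma hdim_short_exactr P M N L (i : hom M N) (q : hom N L) :
  projective P -> short_exact i q -> hdim P N = (hdim P M + hdim P L)%N.
Proof.
move=> pP [ki cq]; apply: dim_exact (hcomp_linearr i) (hcomp_linearr q) _ _ _.
- by move=> g h; apply: (kernel_mono ki).
- by move=> g; apply/pP/(cokernel_epi cq).
- move=> g; split=> [qg|[h <-]]; last by rewrite hcompA ki.1 hcomp0l.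
  by have [h [hE _]] := ki.2 _ _ qg; exists h.
Qed.

(** The contravariant Hom(-, T) is exact only on the left; the retraction [r]
extends morphisms from M to N. *)
Lemma hdim_split_exactl T M N L (i : hom M N) (q : hom N L) (r : hom N M) :
  short_exact i q -> r \oc i = idm M -> hdim N T = (hdim L T + hdim M T)%N.
Proof.
move=> [ki cq] ri.
apply: dim_exact (hcomp_linearl q) (hcomp_linearl i) _ _ _.
- by move=> g h; apply: (cokernel_epi cq).
- by move=> g; exists (g \oc r); rewrite -hcompA ri hcomp_idr.
- move=> g; split=> [gi|[h <-]]; last by rewrite -hcompA ki.1 hcomp0r.
  by have [h [hE _]] := cq.2 _ _ gi; exists h.
Qed.

Lemma hdim_eq0 M N : hdim M N = 0%N <-> forall f : hom M N, f = 0.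
Proof.
rewrite /hdim; split=> [/eqP|h]; last first.
  by apply/eqP; rewrite dimv_eq0 -subv0; apply/subvP=> f _; rewrite (h f) mem0v.
by rewrite dimv_eq0 => /eqP e f; apply/eqP; rewrite -memv0 -e memvf.
Qed.

Lemma hdim_eq1 M N (q : hom M N) :
  q != 0 -> (forall f : hom M N, exists a, f = a *: q) -> hdim M N = 1%N.
Proof.
move=> qn fE; have <- : \dim <[q]>%VS = 1%N by rewrite dim_vline qn.
congr (\dim _); apply/vspaceP => f; rewrite memvf; apply/esym.
by have [a ->] := fE f; rewrite memvZ ?memv_line.
Qed.

Lemma ex_simple_quotient M :
  finite_length M -> zero_object M \/
  exists S (q : hom M S), simple_object S /\ q != 0.
Proof.
case=> [N|N L S i q [_ cq] sS _]; first by left.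
right; exists S, q; split=> //.
exact: epi_neq0 sS.1 (cokernel_epi cq).
Qed.

End LinearCategory.
(** * Duality and adjunction in a monoidal category *)

Section Monoidal.
Variables (k : fieldType) (C : linCat k) (m : monoidal C).
Implicit Types W X Y Z M N P : C.

Local Notation "X \ox Y" := (tens m X Y) (at level 39, left associativity).
Local Notation "X \lx f" := (tensm m (idm X) f) (at level 39).
Local Notation "f \rx X" := (tensm m f (idm X)) (at level 39).
Local Notation one := (tunit m).

(** Rewrites with a composite equation inside a composite associated to the
right. *)
Lemma hcompA_eq X Y Z (g : hom Y Z) (f : hom X Y) h :
  g \oc f = h -> forall W (x : hom W X), g \oc (f \oc x) = h \oc x.
Proof. by move=> e W x; rewrite hcompA e. Qed.

Lemma whisker_lM X M N P (g : hom N P) (f : hom M N) :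
  X \lx (g \oc f) = X \lx g \oc X \lx f.
Proof. by rewrite -tensm_comp hcomp_idl. Qed.

Lemma whisker_rM X M N P (g : hom N P) (f : hom M N) :
  (g \oc f) \rx X = g \rx X \oc f \rx X.
Proof. by rewrite -tensm_comp hcomp_idl. Qed.

Lemma whisker_swap X Y M N (f : hom X Y) (g : hom M N) :
  f \rx N \oc X \lx g = Y \lx g \oc f \rx M.
Proof. by rewrite -!tensm_comp !hcomp_idl !hcomp_idr. Qed.

Lemma assocV_nat X X' Y Y' Z Z' (f : hom X X') (g : hom Y Y') (h : hom Z Z') :
  assocV m X' Y' Z' \oc tensm m f (tensm m g h) =
  tensm m (tensm m f g) h \oc assocV m X Y Z.
Proof.
rewrite -[LHS]hcomp_idr -(assocVK m X Y Z) hcompA -(hcompA _ (tensm m f _)).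
by rewrite -assoc_nat hcompA assocK hcomp_idl.
Qed.

Lemma assoc_iso X Y Z : is_iso (assoc m X Y Z).
Proof. by exists (assocV m X Y Z); split; [exact: assocK | exact: assocVK]. Qed.

Lemma is_iso_whisker_l X M N (f : hom M N) : is_iso f -> is_iso (X \lx f).
Proof.
case=> g [gf fg]; exists (X \lx g).
by split; rewrite -!whisker_lM ?gf ?fg tensm_id.
Qed.

Lemma is_iso_whisker_r X M N (f : hom M N) : is_iso f -> is_iso (f \rx X).
Proof.
case=> g [gf fg]; exists (g \rx X).
by split; rewrite -!whisker_rM ?gf ?fg tensm_id.
Qed.

Lemma unit_whisker_inj M N (f g : hom M N) : one \lx f = one \lx g -> f = g.
Proof.
by move=> e; apply: (is_iso_epi (lunit_iso m M)); rewrite -!lunit_nat e.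
Qed.

Lemma unit_whisker_epi M N (f : hom M N) : epi f -> epi (one \lx f).
Proof.
move=> ef L a b e; have [l [lK lK']] := lunit_iso m N.
rewrite -[a]hcomp_idr -[b]hcomp_idr -lK !hcompA; congr (_ \oc _); apply: ef.
apply: (is_iso_epi (lunit_iso m M)).
rewrite -!hcompA -!lunit_nat !(hcompA_eq lK) !hcomp_idl; exact: e.
Qed.

Lemma pentagon_r W X Y Z :
  W \lx assoc m X Y Z \oc (assoc m W (X \ox Y) Z \oc assoc m W X Y \rx Z) =
  assoc m W X (Y \ox Z) \oc assoc m (W \ox X) Y Z.
Proof. by rewrite hcompA pentagon. Qed.

Lemma pentagonV W X Y Z :
  assocV m W X (Y \ox Z) \oc (W \lx assoc m X Y Z \oc assoc m W (X \ox Y) Z) =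
  assoc m (W \ox X) Y Z \oc assocV m W X Y \rx Z.
Proof.
apply: (is_iso_epi (is_iso_whisker_r Z (assoc_iso W X Y))).
rewrite -!hcompA pentagon_r hcompA assocK hcomp_idl.
by rewrite -whisker_rM assocK tensm_id hcomp_idr.
Qed.

(** Kelly's coherence: the pentagon on (1, 1, X, Y) and the triangle give the
identity after tensoring with the unit, and tensoring with the unit is
faithful. *)
Lemma lunit_tens X Y : lunit m (X \ox Y) \oc assoc m one X Y = lunit m X \rx Y.
Proof.
apply: unit_whisker_inj; rewrite whisker_lM.
apply: (is_iso_epi (assoc_iso one (one \ox X) Y)).
apply: (is_iso_epi (is_iso_whisker_r Y (assoc_iso one one X))).
rewrite -!hcompA pentagon_r (hcompA_eq (triangle m one _)).
rewrite -(tensm_id m X Y) -assoc_nat (hcompA_eq (esym (assoc_nat m _ _ _))).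
by rewrite -hcompA -whisker_rM triangle.
Qed.

(** For a dual pair, Y (x) - is left adjoint to X (x) -. The unit of the
adjunction is kept with source 1 (x) M, which makes it natural without choosing
inverses of the left unitors; the price is a left unitor in the triangle
identities. *)
Section Duality.
Variables (X Y : C) (ev : hom (Y \ox X) one) (coev : hom one (X \ox Y)).
Hypothesis zigzagX : runit m X \oc X \lx ev \oc assoc m X Y X \oc coev \rx X
  = lunit m X.
Hypothesis zigzagY : lunit m Y \oc ev \rx Y \oc assocV m Y X Y \oc Y \lx coev
  = runit m Y.

Definition dual_counit M : hom (Y \ox (X \ox M)) M :=
  lunit m M \oc ev \rx M \oc assocV m Y X M.

Definition dual_unit M : hom (one \ox M) (X \ox (Y \ox M)) :=
  assoc m X Y M \oc coev \rx M.

Lemma dual_counit_nat M N (f : hom M N) :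
  f \oc dual_counit M = dual_counit N \oc Y \lx (X \lx f).
Proof.
rewrite /dual_counit -!hcompA assocV_nat tensm_id.
by rewrite (hcompA_eq (whisker_swap _ _)) !hcompA lunit_nat.
Qed.

Lemma dual_unit_nat M N (f : hom M N) :
  X \lx (Y \lx f) \oc dual_unit M = dual_unit N \oc one \lx f.
Proof.
rewrite /dual_unit hcompA -assoc_nat tensm_id -!hcompA.
by rewrite whisker_swap.
Qed.

Lemma dual_triangleX M :
  X \lx dual_counit M \oc dual_unit (X \ox M) = lunit m (X \ox M).
Proof.
apply: (is_iso_epi (assoc_iso one X M)).
rewrite lunit_tens -zigzagX !whisker_rM.
rewrite -triangle /dual_counit /dual_unit !whisker_lM -!hcompA.
rewrite -(tensm_id m X M) -assoc_nat (hcompA_eq (pentagon m X Y X M)).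
rewrite -!hcompA (hcompA_eq (esym (whisker_lM X (assocV m Y X M) _))).
rewrite assocK tensm_id.
rewrite hcomp_idl (hcompA_eq (esym (assoc_nat m _ _ _))).
by rewrite -!hcompA.
Qed.

Lemma dual_triangleY M :
  dual_counit (Y \ox M) \oc Y \lx dual_unit M = Y \lx lunit m M.
Proof.
apply: (is_iso_epi (assoc_iso Y one M)); rewrite triangle -zigzagY !whisker_rM.
rewrite /dual_counit /dual_unit !whisker_lM -!hcompA -assoc_nat.
rewrite (hcompA_eq (erefl (Y \lx assoc m X Y M \oc assoc m Y (X \ox Y) M))).
rewrite (hcompA_eq (pentagonV Y X Y M)) -!hcompA.
rewrite -(tensm_id m Y M) (hcompA_eq (esym (assoc_nat m _ _ _))) -!hcompA.
by rewrite (hcompA_eq (lunit_tens _ _)).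
Qed.

Lemma dual_transposeK N M (f : hom (Y \ox N) M) :
  dual_counit M \oc Y \lx (X \lx f \oc dual_unit N) = f \oc Y \lx lunit m N.
Proof.
rewrite whisker_lM hcompA -dual_counit_nat -(hcompA f).
by rewrite dual_triangleY.
Qed.

Lemma dual_untransposeK N M (g : hom N (X \ox M)) :
  X \lx (dual_counit M \oc Y \lx g) \oc dual_unit N = g \oc lunit m N.
Proof.
rewrite whisker_lM -(hcompA _ _ (dual_unit N)) dual_unit_nat hcompA.
by rewrite dual_triangleX lunit_nat.
Qed.

(** Left adjoints preserve epimorphisms: the transposes of g and h agree after
composing with q. *)
Lemma tens_dual_epi M N (q : hom M N) : epi q -> epi (Y \lx q).
Proof.
move=> eq L g h e; apply: (is_iso_epi (is_iso_whisker_l Y (lunit_iso m N))).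
rewrite -!dual_transposeK; congr (_ \oc _ \lx _).
apply: (unit_whisker_epi eq).
rewrite -!(hcompA _ (dual_unit N)) -!dual_unit_nat !hcompA.
by rewrite -!whisker_lM e.
Qed.

(** A left adjoint preserves projectives when its right adjoint preserves
epimorphisms: lift the transpose of f. *)
Lemma tens_dual_projective P :
  (forall M N (q : hom M N), epi q -> epi (X \lx q)) ->
  projective P -> projective (Y \ox P).
Proof.
move=> eX pP M N q f eq; have [l [_ lK]] := lunit_iso m P.
have [g gE] := pP _ _ _ (X \lx f \oc dual_unit P \oc l) (eX _ _ _ eq).
exists (dual_counit M \oc Y \lx g).
rewrite hcompA dual_counit_nat -(hcompA (dual_counit N)) -whisker_lM gE.
rewrite whisker_lM hcompA dual_transposeK -(hcompA f) -whisker_lM lK.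
by rewrite tensm_id hcomp_idr.
Qed.

Lemma tens_dual_hdim P M :
  (forall A A' B B' (f : hom A A'), linear (fun g : hom B B' => tensm m f g)) ->
  hdim (Y \ox P) M = hdim P (X \ox M).
Proof.
move=> lt; have [l [lK lK']] := lunit_iso m P.
pose phi (f : hom (Y \ox P) M) := X \lx f \oc dual_unit P \oc l.
apply: (@dim_bij _ _ _ phi); rewrite /phi.
  move=> a f g; rewrite lt.
  by rewrite (hcomp_linearl (dual_unit P)) (hcomp_linearl l).
exists (fun g => dual_counit M \oc Y \lx g) => [f|g].
  rewrite whisker_lM hcompA dual_transposeK -(hcompA f) -whisker_lM lK'.
  by rewrite tensm_id hcomp_idr.
by rewrite dual_untransposeK -hcompA lK' hcomp_idr.
Qed.

End Duality.
End Monoidal.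
Section DualPair.
Variables (k : fieldType) (C : linCat k) (m : monoidal C).
Implicit Types X Y P M : C.

(** The dual pair (X', X) exhibits X (x) - as a left adjoint, so that it
preserves epimorphisms. *)
Lemma dual_pair_projective X' X Y P :
  dual_pair m X' X -> dual_pair m X Y -> projective P ->
  projective (tens m Y P).
Proof.
move=> [ev' [coev' [_ zX]]] [ev [coev [_ zY]]].
apply: (tens_dual_projective zY) => M N q.
exact: (tens_dual_epi zX).
Qed.

Lemma dual_pair_hdim X Y P M :
  bilinear_tensor m -> dual_pair m X Y ->
  hdim (tens m Y P) M = hdim P (tens m X M).
Proof.
move=> bil [ev [coev [zX zY]]]; apply: (tens_dual_hdim zX zY).
by move=> A A' B B'; case: (bil A A' B B').
Qed.

End DualPair.

Section Reverse.
Variables (k : fieldType) (C : linCat k) (m : monoidal C).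

Lemma rev_pentagon (W X Y Z : C) :
  assocV m (tens m Z Y) X W \oc assocV m Z Y (tens m X W) =
  tensm m (assocV m Z Y X) (idm W) \oc assocV m Z (tens m Y X) W
    \oc tensm m (idm Z) (assocV m Y X W).
Proof.
apply: (is_iso_epi (assoc_iso m Z Y (tens m X W))).
apply: (is_iso_epi (assoc_iso m (tens m Z Y) X W)).
rewrite -!hcompA (hcompA_eq (assocK _ _ _ _)) hcomp_idl assocK.
rewrite pentagon -!hcompA.
rewrite (hcompA_eq (esym (whisker_lM m Z (assocV m Y X W) _))) assocK tensm_id.
rewrite hcomp_idl (hcompA_eq (assocK _ _ _ _)) hcomp_idl -whisker_rM assocK.
by rewrite tensm_id.
Qed.

Lemma rev_triangle (X Y : C) :
  tensm m (runit m Y) (idm X) \oc assocV m Y (tunit m) X =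
  tensm m (idm Y) (lunit m X).
Proof. by rewrite -triangle -hcompA assocVK hcomp_idr. Qed.

(** The reversed tensor product exchanges left and right duals, so that
statements on Y (x) - transfer to - (x) Y. *)
Definition rev_monoidal : monoidal C :=
  @Monoidal k C (fun X Y => tens m Y X) (fun _ _ _ _ f g => tensm m g f)
    (fun X Y => tensm_id m Y X)
    (fun _ _ _ _ _ _ f' f g' g => tensm_comp m g' g f' f)
    (tunit m) (fun X Y Z => assocV m Z Y X) (fun X Y Z => assoc m Z Y X)
    (fun X Y Z => assocVK m Z Y X) (fun X Y Z => assocK m Z Y X)
    (fun _ _ _ _ _ _ f g h => assocV_nat m h g f)
    (runit m) (runit_iso m) (runit_nat m) (lunit m) (lunit_iso m) (lunit_nat m)
    rev_pentagon rev_triangle.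

Lemma rev_bilinear : bilinear_tensor m -> bilinear_tensor rev_monoidal.
Proof. by move=> bil X X' Y Y'; case: (bil Y Y' X X'). Qed.

Lemma rev_dual_pair X Y : dual_pair m X Y -> dual_pair rev_monoidal Y X.
Proof. by case=> ev [coev [zX zY]]; exists ev, coev. Qed.

End Reverse.
(** * Simple objects and projective covers *)

Section Simple.
Variables (k : closedFieldType) (C : linCat k).
Hypothesis abC : abelian_category C.
Implicit Types M N S T P : C.

(** An eigenvector g of f o - on End(S), with eigenvalue a, is killed by f - a;
a nonzero endomorphism of S is mono, so f = a. *)
Lemma schur S (f : hom S S) : simple_object S -> exists a, f = a *: idm S.
Proof.
move=> sS; have idn : idm S != 0 by apply/eqP => /zero_objectP /sS.1.
have [a [g gn fg]] := closed_eigenvector (hcomp_linearr f) idn.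
exists a; apply/subr0_eq/eqP/negPn/negP => /(simple_mono abC sS) /mono0 fa.
case/eqP: gn; apply: fa.
by rewrite hcompBl fg hcompZl hcomp_idl subrr.
Qed.

(** It suffices that f kills the kernel i of q. Otherwise f i is epi, hence
f = f i h for some h; now q (1 - i h) = q is epi, thus 1 - i h is epi because q
is essential, and f (1 - i h) = 0 gives f = 0. *)
Lemma cover_factor S P T (q : hom P S) (f : hom P T) :
  projective P -> epi q -> (forall M (g : hom M P), epi (q \oc g) -> epi g) ->
  simple_object T -> exists g, f = g \oc q.
Proof.
move=> pP eq ess sT; have [K [i ki]] := ex_kernel abC q.
have fi : f \oc i = 0.
  apply/eqP/negPn/negP => fin.
  have [h hE] := pP _ _ _ f (simple_epi abC sT fin).
  have e : epi (idm P - i \oc h).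
    by apply: ess; rewrite hcompBr hcomp_idr hcompA ki.1 hcomp0l subr0.
  case/eqP: fin; suff -> : f = 0 by rewrite hcomp0l.
  move/epi0: e; apply.
  by rewrite hcompBr hcomp_idr hcompA hE subrr.
by have [g [gE _]] := (epi_exact abC eq ki).2.2 _ _ fi; exists g.
Qed.

Lemma hdim_cover S P :
  simple_object S -> projective_cover S P -> hdim P S = 1%N.
Proof.
move=> sS [pP [q eq ess]]; apply: hdim_eq1 (epi_neq0 sS.1 eq) _ => f.
have [g ->] := cover_factor f pP eq ess sS.
by have [a ->] := schur g sS; exists a; rewrite hcompZl hcomp_idl.
Qed.

Lemma hdim_cover0 S P T :
  simple_object S -> projective_cover S P -> simple_object T ->
  ~ isomorphic S T -> hdim P T = 0%N.
Proof.
move=> sS [pP [q eq ess]] sT nST; apply/hdim_eq0 => f.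
have [g ->] := cover_factor f pP eq ess sT.
have [->|gn] := eqVneq g 0; first by rewrite hcomp0l.
by case: nST; exists g; apply: simple_nonzero_iso.
Qed.

(** Lifting f to the cover gives a map M -> P, epi because P -> S is essential
and split because P is projective. *)
Lemma cover_split S P M (f : hom M S) :
  projective_cover S P -> projective M -> epi f ->
  exists K (i : hom K M) (q : hom M P) (r : hom M K),
    short_exact i q /\ r \oc i = idm K.
Proof.
move=> [pP [q eq ess]] pM ef.
have [g gE] := pM _ _ _ f eq.
have eg : epi g by apply: ess; rewrite gE.
have [s sE] := pP _ _ _ (idm P) eg.
have [K [i ki]] := ex_kernel abC g.
have [se [r rE]] := split_epi_exact abC sE ki.
by exists K, i, g, r.
Qed.

Definition exact_additive (V : zmodType) (phi : C -> V) : Prop :=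
  forall M N L (i : hom M N) (q : hom N L),
    short_exact i q -> phi N = phi M + phi L.

Lemma iso_exact Z M N (f : hom M N) :
  zero_object Z -> is_iso f -> short_exact (0 : hom Z M) f.
Proof.
move=> zZ [g [gf fg]]; split; split; rewrite ?hcomp0r //.
  move=> L h fh; exists 0; split=> [|u _]; last exact: (esym (zZ.1 _ u)).
  by rewrite hcomp0r -[h]hcomp_idl -gf -hcompA fh hcomp0r.
move=> L h _; exists (h \oc g); split=> [|u <-].
  by rewrite -hcompA gf hcomp_idr.
by rewrite -hcompA fg hcomp_idr.
Qed.

Section Additive.
Variables (V : zmodType) (phi : C -> V).
Hypothesis aphi : exact_additive phi.

Lemma exact_additive0 Z : zero_object Z -> phi Z = 0.
Proof.
move=> zZ; have : is_iso (idm Z) by exists (idm Z); rewrite hcomp_idl.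
by move/(iso_exact zZ)/aphi/(congr1 (+%R^~ (- phi Z))); rewrite addrK subrr.
Qed.

Lemma exact_additive_iso M N : isomorphic M N -> phi M = phi N.
Proof.
case: abC => -[Z zZ] _ _ _ _ [f /(iso_exact zZ)/aphi ->].
by rewrite exact_additive0 // add0r.
Qed.

End Additive.

Lemma hdim_exact_additive P :
  projective P -> exact_additive (fun M => (hdim P M)%:Z).
Proof. by move=> pP M N L i q /(hdim_short_exactr pP) ->. Qed.

End Simple.

(** * Projective objects in the Grothendieck ring *)

Section Grothendieck.
Variables (k : closedFieldType) (C : finTensorCat k) (n : nat) (X : 'I_n -> C).
Variable A : grothendieckRing X.

Local Notation cls := (gr_class A).
Local Notation coord := (@gr_coord k C n X A).

Lemma gr_coord_zmod_morphism : zmod_morphism coord.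
Proof.
move=> a b; rewrite -{1}(gr_coordK a) -{1}(gr_coordK b) -sumrB.
rewrite -[RHS](gr_coord_sum A); congr (coord _); apply: eq_bigr => i _.
by rewrite !mxE mulrzBr.
Qed.

HB.instance Definition _ :=
  GRing.isZmodMorphism.Build _ _ coord gr_coord_zmod_morphism.

Lemma coord_simple i : coord (cls (X i)) = delta_mx 0 i.
Proof.
rewrite -[RHS](gr_coord_sum A); congr (coord _).
rewrite (bigD1 i) //= mxE !eqxx mulr1z big1 ?addr0 // => j /negPf ji.
by rewrite mxE ji andbF mulr0z.
Qed.

Lemma coord_mull x b j :
  coord (x * b) 0 j = \sum_i coord (cls (X i) * b) 0 j * coord x 0 i.
Proof.
rewrite -{1}(gr_coordK x) mulr_suml raddf_sum summxE; apply: eq_bigr => i _.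
by rewrite mulrzAl raddfMz /= -scaler_int mxE intz mulrC.
Qed.

Lemma gr_class_exact_additive : exact_additive cls.
Proof. move=> M N L i q; exact: gr_exact. Qed.

Hypothesis hX : simple_reps X.
Let fC := ftc_finite C.
Let abC : abelian_category C. Proof. by case: fC. Qed.
Let flC (M : C) : finite_length M. Proof. by case: fC => _ /(_ M). Qed.
Let sX i : simple_object (X i). Proof. by case: hX => /(_ i). Qed.

(** The universal property of the Grothendieck group, by induction on a
composition series. *)
Lemma exact_additive_coord (V : zmodType) (phi : C -> V) (M : C) :
  exact_additive phi -> phi M = \sum_i phi (X i) *~ coord (cls M) 0 i.
Proof.
move=> aphi; elim: (flC M) => {M} [M zM|M N S i q ex sS _ IH].
  rewrite (exact_additive0 aphi zM).
  rewrite (exact_additive0 gr_class_exact_additive zM).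
  by rewrite raddf0 big1 // => i _; rewrite mxE mulr0z.
rewrite (aphi _ _ _ _ _ ex) (gr_exact A ex) IH raddfD /=.
have [_ _ /(_ _ sS) [j Sj]] := hX.
rewrite (exact_additive_iso abC aphi Sj).
rewrite (exact_additive_iso abC gr_class_exact_additive Sj) coord_simple.
under [RHS]eq_bigr => l _ do rewrite mxE mulrzDr.
rewrite big_split /=; congr (_ + _).
rewrite (bigD1 j) //= mxE !eqxx mulr1z big1 ?addr0 // => l /negPf lj.
by rewrite mxE lj andbF mulr0z.
Qed.

Variable P : 'I_n -> C.
Hypothesis hP : forall i, projective_cover (X i) (P i).
Let pP i : projective (P i). Proof. by case: (hP i). Qed.

Lemma hdim_cover_simple i j : hdim (P i) (X j) = (i == j) :> nat.
Proof.
have [<-|/eqP ij] := eqVneq; first exact: hdim_cover (sX i) (hP i).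
apply: (hdim_cover0 abC (sX i) (hP i) (sX j)) => /[dup] Xij.
by have [_ /(_ i j Xij)] := hX.
Qed.

(** Both sides are additive on short exact sequences and agree on simple
objects. *)
Lemma hdim_coverE i M : (hdim (P i) M)%:Z = coord (cls M) 0 i.
Proof.
rewrite (exact_additive_coord M (hdim_exact_additive (@pP i))).
rewrite (bigD1 i) //= hdim_cover_simple eqxx.
rewrite big1 ?addr0 => [|j /negPf ji]; first by rewrite intz.
by rewrite hdim_cover_simple eq_sym ji mul0rz.
Qed.

(** A nonzero projective object has a simple quotient X_j and therefore a
direct summand P_j; the complement is projective and has a smaller total
dimension of Homs to the simple objects. *)
Lemma projective_class M :
  projective M -> cls M = \sum_j cls (P j) *+ hdim M (X j).
Proof.
have [s] := ubnP (\sum_j hdim M (X j))%N.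
elim: s M => // s IH M; rewrite ltnS => lt pM.
have [zM|[S [q [sS qn]]]] := ex_simple_quotient (flC M).
  rewrite (exact_additive0 gr_class_exact_additive zM) big1 // => j _.
  by rewrite (hdim_eq0 M (X j)).2 // => f; apply: zM.2.
have [_ _ /(_ _ sS) [j [f fi]]] := hX.
have ef : epi (f \oc q).
  by apply: epi_comp (simple_epi abC sS qn) (is_iso_epi fi).
have [K [i [g [r [ex ri]]]]] := cover_split abC (hP j) pM ef.
have hd l : hdim M (X l) = ((j == l) + hdim K (X l))%N.
  by rewrite (hdim_split_exactl _ ex ri) hdim_cover_simple.
rewrite (gr_exact A ex) addrC (IH K).
- under [RHS]eq_bigr => l _ do rewrite hd mulrnDr.
  rewrite big_split /=; congr (_ + _).
  rewrite (bigD1 j) //= eqxx big1 ?addr0 // => l /negPf lj.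
  by rewrite eq_sym lj.
- apply: leq_trans lt; rewrite (eq_bigr _ (fun l _ => hd l)) big_split /=.
  by rewrite -[ltnLHS]add0n ltn_add2r (bigD1 j) //= eqxx.
- exact: projective_retract pM ri.
Qed.

(** The object N is a dual of M: the class of the projective object N (x) P_i
is computed by [projective_class], and Hom(N (x) P_i, X_j) = Hom(P_i, M (x) X_j)
by adjunction. *)
Lemma cover_mull M : exists N, forall i,
  cls N * cls (P i) = \sum_j cls (P j) *~ coord (cls M * cls (X j)) 0 i.
Proof.
have [[N MN] [N' N'M]] := ftc_rigid M; exists N => i.
rewrite -gr_tens (projective_class (dual_pair_projective N'M MN (@pP i))).
apply: eq_bigr => j _.
by rewrite (dual_pair_hdim _ _ (@ftc_bilinear k C) MN) -gr_tens -hdim_coverE.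
Qed.

(** Same argument in the reversed category, where tensoring with the dual N of
M on the right is right adjoint to tensoring with M on the right. *)
Lemma cover_mulr M : exists N, forall i,
  cls (P i) * cls M = \sum_j cls (P j) *~ coord (cls (X j) * cls N) 0 i.
Proof.
have [[N MN] _] := ftc_rigid M; have [[N' NN'] _] := ftc_rigid N.
exists N => i.
have pr := dual_pair_projective (rev_dual_pair NN') (rev_dual_pair MN) (@pP i).
rewrite -gr_tens (projective_class pr); apply: eq_bigr => j _.
have bil := rev_bilinear (@ftc_bilinear k C).
rewrite (dual_pair_hdim _ _ bil (rev_dual_pair MN)).
by rewrite -gr_tens -hdim_coverE.
Qed.

(** * Left eigenvectors of the Grothendieck ring *)

Section FPdim.
Variables (R : realType) (FPdim : {rmorphism A -> R}).
Hypothesis hFPdim : FPdim_character FPdim.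

Local Notation dim := (FPdim_obj FPdim).

Lemma FPdim_coord x : FPdim x = \sum_i (coord x 0 i)%:~R * dim (X i).
Proof.
rewrite -{1}(gr_coordK x) raddf_sum; apply: eq_bigr => i _.
by rewrite raddfMz /= mulrzl.
Qed.

Lemma dim_cover_gt0 i : 0 < dim (P i).
Proof.
rewrite /FPdim_obj FPdim_coord (bigD1 i) //= -hdim_coverE ltr_wpDr //.
  apply: sumr_ge0 => j _; rewrite -hdim_coverE.
  by rewrite mulr_ge0 ?ler0z // ltW //; apply: hFPdim.
rewrite mulr_gt0 ?hFPdim // ltr0z ltz_nat lt0n; apply/eqP => /hdim_eq0 z.
have [_ [q eq _]] := hP i.
by case/eqP: (epi_neq0 (sX i).1 eq); rewrite -[q]hcomp_idr (z (idm _)) hcomp0r.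
Qed.

Lemma FPdim_cat_gt0 : (0 < n)%N -> 0 < FPdim_cat FPdim P.
Proof.
move=> n0; rewrite /FPdim_cat (bigD1 (Ordinal n0)) //= ltr_pwDl //.
  by rewrite mulr_gt0 ?dim_cover_gt0 //; apply: hFPdim.
apply: sumr_ge0 => i _.
by rewrite mulr_ge0 ?(ltW (dim_cover_gt0 _)) // ltW //; apply: hFPdim.
Qed.

Definition left_eigenvector (v : 'I_n -> R) : Prop := forall i l,
  \sum_j v j * (coord (cls (X i) * cls (X j)) 0 l)%:~R = dim (X i) * v l.

(** The eigenvector equation is linear in the acting element, hence holds for
every element of the ring and not only for the basis. *)
Lemma left_eigenvector_lin v x l : left_eigenvector v ->
  \sum_j v j * (coord (x * cls (X j)) 0 l)%:~R = FPdim x * v l.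
Proof.
move=> ev; rewrite FPdim_coord mulr_suml.
under [RHS]eq_bigr => i _ do rewrite -mulrA -ev mulr_sumr.
rewrite exchange_big; apply: eq_bigr => j _ /=.
rewrite coord_mull rmorph_sum mulr_sumr; apply: eq_bigr => i _ /=.
by rewrite rmorphM /= mulrC mulrAC mulrC [X in _ * X]mulrC.
Qed.

(** Taking dimensions in [cover_mull] gives the eigenvalue dim N, for N a dual
of X_i. Pairing with the vector of the d_l, an eigenvector on the right with
eigenvalue d_i, and dividing by FPdim(C) identifies dim N with d_i. *)
Lemma dim_cover_eigenvector :
  FPdim_cat FPdim P != 0 -> left_eigenvector (fun j => dim (P j)).
Proof.
move=> G0 i; have [N NE] := cover_mull (X i).
have e l : \sum_j dim (P j) * (coord (cls (X i) * cls (X j)) 0 l)%:~R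
           = dim N * dim (P l).
  rewrite -[RHS]rmorphM NE raddf_sum; apply: eq_bigr => j _.
  by rewrite raddfMz /= mulrzr.
suff dN : dim N = dim (X i) by move=> l; rewrite e dN.
apply: (mulIf G0); rewrite /FPdim_cat !mulr_sumr.
under eq_bigr => l _ do rewrite mulrCA -e mulr_sumr.
rewrite exchange_big; apply: eq_bigr => j _ /=.
rewrite mulrA -[dim (X i) * _]rmorphM FPdim_coord mulr_suml.
apply: eq_bigr => l _; rewrite mulrCA [RHS]mulrC; congr (_ * _).
exact: mulrC.
Qed.

Hypothesis hint : integral_category FPdim.

Let zdim M : int := Num.floor (dim M).
Let zdimE M : (zdim M)%:~R = dim M.
Proof. by apply: floorK; apply: hint. Qed.

(** The class of the regular module when C is the category of
representations of a quasi-Hopf algebra. *)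
Definition regular_class : A := \sum_i cls (P i) *~ zdim (X i).

Lemma FPdim_regular : FPdim regular_class = FPdim_cat FPdim P.
Proof.
rewrite raddf_sum; apply: eq_bigr => i _.
by rewrite raddfMz /= -mulrzl zdimE.
Qed.

(** By [cover_mulr] the coefficient of [P_j] in the product is
sum_i d_i c_i([X_j][N]) = dim(X_j) dim(N), for N a dual of M. Thus the product
is dim(N) times the regular class, and applying FPdim shows dim(N) = dim(M). *)
Lemma regular_class_absorbs M : FPdim_cat FPdim P != 0 ->
  regular_class * cls M = regular_class *~ zdim M.
Proof.
move=> G0; have [N NE] := cover_mulr M.
have e : regular_class * cls M = regular_class *~ zdim N.
  rewrite mulr_suml -[RHS]mulrzl mulr_sumr.
  under eq_bigr => i _ do rewrite mulrzAl NE mulrz_suml.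
  rewrite exchange_big; apply: eq_bigr => j _ /=.
  rewrite mulrzl -mulrzA; under eq_bigr => i _ do rewrite -mulrzA.
  rewrite -mulrz_sumr.
  congr (_ *~ _); apply: (@intr_inj R).
  rewrite rmorph_sum rmorphM /= !zdimE -rmorphM FPdim_coord.
  by apply: eq_bigr => i _; rewrite rmorphM /= zdimE.
rewrite e; congr (_ *~ _); apply: (@intr_inj R); rewrite !zdimE.
apply: (mulfI G0); rewrite -FPdim_regular -[RHS]rmorphM e raddfMz /=.
by rewrite -mulrzr zdimE.
Qed.

(** The equation of [left_eigenvector_lin] at the regular class r, using
r [X_j] = d_j r. *)
Lemma left_eigenvector_regular v l :
  FPdim_cat FPdim P != 0 -> left_eigenvector v ->
  FPdim_cat FPdim P * v l =
    (\sum_j v j * dim (X j)) * (coord regular_class 0 l)%:~R.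
Proof.
move=> G0 ev; rewrite -FPdim_regular -(left_eigenvector_lin _ _ ev) mulr_suml.
apply: eq_bigr => j _; rewrite regular_class_absorbs // raddfMz /=.
by rewrite -scaler_int mxE intz rmorphM /= zdimE mulrA.
Qed.

(** Applying [left_eigenvector_regular] to the dimensions of the covers, for
which the pairing with the d_j is FPdim(C), identifies them with the coordinates
of the regular class. *)
Lemma left_eigenvector_dim_cover v l :
  FPdim_cat FPdim P != 0 -> left_eigenvector v ->
  FPdim_cat FPdim P * v l = (\sum_j v j * dim (X j)) * dim (P l).
Proof.
move=> G0 ev; rewrite (left_eigenvector_regular _ G0 ev); congr (_ * _).
apply: (mulfI G0).
rewrite (left_eigenvector_regular _ G0 (dim_cover_eigenvector G0)).
by congr (_ * _); apply: eq_bigr => j _; rewrite mulrC.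
Qed.

End FPdim.
End Grothendieck.

Lemma biggcdn_mull n (F : 'I_n -> nat) c :
  \big[gcdn/0%N]_(i < n) (c * F i)%N = (c * \big[gcdn/0%N]_(i < n) F i)%N.
Proof. by rewrite big_endo ?muln0 // => x y; rewrite muln_gcdr. Qed.

Lemma dvdn_biggcd n (F : 'I_n -> nat) e :
  (forall i, (e %| F i)%N) -> (e %| \big[gcdn/0%N]_(i < n) F i)%N.
Proof. by move=> h; elim/big_ind: _ => // x y; rewrite dvdn_gcd => -> ->. Qed.

Theorem proposition2p4 (k : closedFieldType) (R : realType)
  (C : finTensorCat k)
  (n : nat) (X : 'I_n -> C) (hX : simple_reps X)
  (P : 'I_n -> C) (hP : forall i : 'I_n, projective_cover (X i) (P i))
  (A : grothendieckRing X)
  (FPdim : {rmorphism A -> R}) (hFPdim : FPdim_character FPdim)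
  (hint : integral_category FPdim)
  (D : nat) (hD : gcd_projective_dims FPdim D)
  (p : 'rV[nat]_n) (hp : canonical_left_eigenvector FPdim p) :
  FPdim_cat FPdim P = D%:R * FPdim_ring FPdim p.
Proof.
have [p0 pE p1] := hp.
have n0 : (0 < n)%N.
  (* the gcd of an empty family is 0 *)
  by rewrite lt0n; apply/eqP => n0; subst n; rewrite big_ord0 in p1.
have G0 : 0 < FPdim_cat FPdim P by apply: FPdim_cat_gt0.
have dim_nat M : 0 <= FPdim_obj FPdim M ->
    exists r : nat, FPdim_obj FPdim M = r%:R.
  by move=> ge0; apply/natrP; rewrite natrEint hint.
have [d dE] := fin_all_exists (fun i => dim_nat _ (ltW (hFPdim i))).
have [pi piE] :=
  fin_all_exists (fun i => dim_nat _ (ltW (dim_cover_gt0 hX hP hFPdim i))).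
have hp' : left_eigenvector FPdim (fun j => (p ord0 j)%:R).
  move=> i l; have /matrixP/(_ 0 l) := pE i; rewrite !mxE => <-.
  by apply: eq_bigr => j _; rewrite !mxE.
have prop l := left_eigenvector_dim_cover hX hP hint l (lt0r_neq0 G0) hp'.
pose G := (\sum_(i < n) d i * pi i)%N.
pose F := (\sum_(i < n) p ord0 i * d i)%N.
have GE : FPdim_cat FPdim P = G%:R.
  by rewrite natr_sum; apply: eq_bigr => i _; rewrite dE piE natrM.
have FE : FPdim_ring FPdim p = F%:R.
  by rewrite natr_sum; apply: eq_bigr => i _; rewrite dE natrM.
have DE : D = \big[gcdn/0%N]_(i < n) pi i.
  apply/eqP; rewrite eqn_dvd; apply/andP; split.
    by apply: dvdn_biggcd => i; apply: hD.1 (piE i); case: (hP i).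
  apply: hD.2 => M r pM rE.
  have -> : r = (\sum_j pi j * hdim M (X j))%N.
    apply/eqP; rewrite -(eqr_nat R) -rE /FPdim_obj.
    rewrite (projective_class A hX hP pM).
    rewrite raddf_sum natr_sum; apply/eqP; apply: eq_bigr => j _.
    by rewrite raddfMn /= natrM -piE mulr_natr.
  apply: dvdn_sum => j _; apply: dvdn_mulr.
  by rewrite (bigD1 j) //= dvdn_gcdl.
rewrite GE FE -natrM mulnC; congr (_%:R).
rewrite -[LHS]muln1 -p1 DE -!biggcdn_mull; apply: eq_bigr => l _.
by apply/eqP; rewrite -(eqr_nat R) !natrM -GE -FE -piE; apply/eqP/prop.
Qed.
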